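(* For any $X\in\mathcal{O}^{d,r}$, $\mathbb{P}_\circ\in\mathscr{Q}_2$ and $\rho\ge 0$, with $p=2$, $$\varphi(X)=\Big(\big(\mathrm{tr}((I_d-XX^\top)\Sigma_\circ)\big)^{1/2}+\rho\Big)^2 .$$ Consequently, for every $X\in\mathcal{O}^{d,r}$ and any function $s:\mathbb{R}^{d\times r}\to\mathbb{R}$, $$\varphi(X)+s(X)=\mathrm{tr}((I_d-XX^\top)\Sigma_\circ)+s(X)+2\rho\,\|(I_d-XX^\top)\Sigma_\circ^{1/2}\|_{\mathrm F}+\rho^2,$$ so minimizing $\varphi+s$ over $\mathcal{O}^{d,r}$ is equivalent to minimizing $\mathrm{tr}((I_d-XX^\top)\Sigma_\circ)+s(X)+2\rho\|(I_d-XX^\top)\Sigma_\circ^{1/2}\|_{\mathrm F}$ over $\mathcal{O}^{d,r}$.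
   Context: Let $d,r$ be integers with $1\le r<d$ and $\mathcal{O}^{d,r}=\{X\in\mathbb{R}^{d\times r}: X^\top X=I_r\}$. $\mathscr{Q}_2$ is the set of Borel probability distributions on $\mathbb{R}^d$ with finite second moment, and $\mathbb{W}_2(\mathbb{P}_1,\mathbb{P}_2)=\inf_{\mathbb{Q}\in\mathscr{J}(\mathbb{P}_1,\mathbb{P}_2)}\big(\mathbb{E}_{(\xi_1,\xi_2)\sim\mathbb{Q}}\|\xi_1-\xi_2\|_2^2\big)^{1/2}$, with $\mathscr{J}(\mathbb{P}_1,\mathbb{P}_2)$ the set of couplings. For $X\in\mathcal{O}^{d,r}$, $\varphi(X)=\sup\{\mathbb{E}_{\mathbb{P}}\big[\|(I_d-XX^\top)(\xi-\mathbb{E}_{\mathbb{P}}[\xi])\|_2^2\big]:\mathbb{P}\in\mathscr{Q}_2,\ \mathbb{W}_2(\mathbb{P},\mathbb{P}_\circ)\le\rho\}$. $\Sigma_\circ=\mathbb{E}_{\mathbb{P}_\circ}[(\xi-\mathbb{E}_{\mathbb{P}_\circ}[\xi])(\xi-\mathbb{E}_{\mathbb{P}_\circ}[\xi])^\top]$ and $\Sigma_\circ^{1/2}$ its positive semidefinite square root. *)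

(* Defs.v *)
From HB Require Import structures.
From mathcomp Require Import all_boot all_order all_algebra.
From mathcomp Require Import all_classical all_reals all_analysis.
Set Implicit Arguments. Unset Strict Implicit. Unset Printing Implicit Defensive.
Import Order.TTheory GRing.Theory Num.Theory.
Import numFieldNormedType.Exports.
Local Open Scope classical_set_scope.
Local Open Scope ring_scope.

Definition Rd (R : realType) (d : nat) :=
  g_sigma_algebraType (@open 'cV[R]_d).

Definition norm2sq (R : realType) (d : nat) (v : 'cV[R]_d) : R :=
  \sum_(i < d) (v i ord0) ^+ 2.

Definition frob (R : realType) (m n : nat) (A : 'M[R]_(m, n)) : R :=
  Num.sqrt (\sum_(i < m) \sum_(j < n) (A i j) ^+ 2).

Definition stiefel (R : realType) (d r : nat) : set 'M[R]_(d, r) :=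
  [set X | X^T *m X = 1%:M].

Definition Q2 (R : realType) (d : nat) : set (probability (Rd R d) R) :=
  [set P | (integral P setT (fun x : Rd R d => (norm2sq (x : 'cV[R]_d))%:E) < +oo)%E].

Definition meanv (R : realType) (d : nat) (P : probability (Rd R d) R)
  : 'cV[R]_d :=
  \col_(i < d) Rintegral P setT (fun x : Rd R d => (x : 'cV[R]_d) i ord0).

Definition covm (R : realType) (d : nat) (P : probability (Rd R d) R)
  : 'M[R]_d :=
  \matrix_(i < d, j < d) Rintegral P setT (fun x : Rd R d =>
     ((x : 'cV[R]_d) i ord0 - meanv P i ord0) *
     ((x : 'cV[R]_d) j ord0 - meanv P j ord0)).

Definition couplings (R : realType) (d : nat) (P1 P2 : probability (Rd R d) R)
  : set (probability (Rd R d * Rd R d)%type R) :=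
  [set Q | forall A : set (Rd R d), measurable A ->
      Q (fst @^-1` A) = P1 A /\ Q (snd @^-1` A) = P2 A].

(* 2-Wasserstein distance (an extended real, with the convention
   (+oo)^{1/2} = +oo) *)
Definition W2 (R : realType) (d : nat) (P1 P2 : probability (Rd R d) R)
  : \bar R :=
  sqrte (ereal_inf [set integral Q setT (fun z : (Rd R d * Rd R d)%type =>
            (norm2sq ((z.1 : 'cV[R]_d) - (z.2 : 'cV[R]_d)))%:E)
          | Q in couplings P1 P2]).

Definition phi (R : realType) (d r : nat) (P0 : probability (Rd R d) R)
  (rho : R) (X : 'M[R]_(d, r)) : \bar R :=
  ereal_sup [set integral P setT (fun x : Rd R d =>
       (norm2sq ((1%:M - X *m X^T) *m ((x : 'cV[R]_d) - meanv P)))%:E)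
     | P in [set P | Q2 P /\ (W2 P P0 <= rho%:E)%E]].

Definition psd (R : realType) (d : nat) (S : 'M[R]_d) : Prop :=
  S^T = S /\ forall v : 'cV[R]_d, 0 <= (v^T *m S *m v) ord0 ord0.

(* Main.v *)
Require Import Defs.
From HB Require Import structures.
From mathcomp Require Import all_boot all_order all_algebra.
From mathcomp Require Import all_classical all_reals all_analysis.
From mathcomp Require Import measurable_realfun ring lra.
Import Order.TTheory GRing.Theory Num.Theory.
Import numFieldNormedType.Exports.
Local Open Scope classical_set_scope.
Local Open Scope ring_scope.
Set Implicit Arguments.
Unset Strict Implicit.
Unset Printing Implicit Defensive.

(** Write E = I - X X^T, V = tr (E Sigma) and |E (x - m)|^2 for the residual.
    Upper bound: for a coupling (x, y) of P and P0 the mean of P minimises the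
    expected residual, so it may be replaced by the mean m0 of P0; then
    |E (x - m0)|^2 <= (1 + t) |E (y - m0)|^2 + (1 + 1/t) |x - y|^2, and
    optimising over t > 0 gives (sqrt V + rho)^2, without Minkowski's
    inequality.  Lower bound: if V > 0, dilate P0 around m0 along the range
    of E by the factor 1 + rho / sqrt V; if V = 0, perturb P0 by an
    independent random sign times rho u, where u is a unit vector with
    E u = u, which exists because r < d. *)

(** * Expectations of squared norms of affine images *)

(* Pairs integrability with the value, so that both are propagated by one rule
   per operation. *)
Definition integrates (disp : measure_display) (T : measurableType disp)
    (R : realType) (mu : probability T R) (f : T -> R) (v : R) : Prop :=
  mu.-integrable setT (EFin \o f) /\ Rintegral mu setT f = v.

Lemma integrates_integral (disp : measure_display) (T : measurableType disp)
    (R : realType) (mu : probability T R) (f : T -> R) (v : R) :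
  integrates mu f v -> (\int[mu]_x (f x)%:E = v%:E)%E.
Proof. by case=> fi <-; rewrite /Rintegral fineK//; exact: integrable_fin_num. Qed.

Lemma integratesD (disp : measure_display) (T : measurableType disp)
    (R : realType) (mu : probability T R) (f g : T -> R) (u v : R) :
  integrates mu f u -> integrates mu g v ->
  integrates mu (fun x => f x + g x) (u + v).
Proof.
move=> [fi <-] [gi <-]; split; last exact: RintegralD.
exact: (integrableD _ fi gi).
Qed.

Lemma integratesZ (disp : measure_display) (T : measurableType disp)
    (R : realType) (mu : probability T R) (k : R) (f : T -> R) (v : R) :
  integrates mu f v -> integrates mu (fun x => k * f x) (k * v).
Proof.
move=> [fi <-]; split; last exact: RintegralZl.
exact: (integrableZl _ k fi).
Qed.

Lemma integrates_cst (disp : measure_display) (T : measurableType disp)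
    (R : realType) (mu : probability T R) (k : R) :
  integrates mu (fun=> k) k.
Proof.
split; first exact: finite_measure_integrable_cst.
rewrite Rintegral_cst// (_ : fine _ = 1) ?mulr1//.
exact: (congr1 fine (probability_setT mu)).
Qed.

Lemma integrates_sum (disp : measure_display) (T : measurableType disp)
    (R : realType) (mu : probability T R) (I : Type) (s : seq I)
    (f : I -> T -> R) (v : I -> R) :
  (forall i, integrates mu (f i) (v i)) ->
  integrates mu (fun x => \sum_(i <- s) f i x) (\sum_(i <- s) v i).
Proof.
move=> fv; elim: s => [|i s IH].
  rewrite big_nil (_ : (fun x => _) = (fun=> 0)); first exact: integrates_cst.
  by apply/funext => x; rewrite big_nil.
rewrite big_cons (_ : (fun x => _) = (fun x => f i x + \sum_(j <- s) f j x)).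
  exact: integratesD.
by apply/funext => x; rewrite big_cons.
Qed.

(** Expanding each coordinate's square leaves a quadratic part, whose mean is a diagonal entry of
    [A *m C *m A^T], a linear part of mean 0 because [y] is centred, and a constant. *)
Lemma integrates_norm2sq_affine (disp : measure_display)
    (T : measurableType disp) (R : realType) (mu : probability T R)
    (n k : nat) (y : T -> 'cV[R]_n) (C : 'M[R]_n) (A : 'M[R]_(k, n))
    (w : 'cV[R]_k) :
  (forall j, integrates mu (fun x => y x j ord0) 0) ->
  (forall j l, integrates mu (fun x => y x j ord0 * y x l ord0) (C j l)) ->
  integrates mu (fun x => norm2sq (A *m y x + w))
    (\tr (A *m C *m A^T) + norm2sq w).
Proof.
move=> y0 yC.
rewrite (_ : (fun x => _) = (fun x => \sum_(i < k)
   (\sum_(j < n) \sum_(l < n) (A i j * A i l) * (y x j ord0 * y x l ord0) +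
    (\sum_(j < n) (2 * w i ord0 * A i j) * y x j ord0 + w i ord0 ^+ 2)))); last first.
  apply/funext => x; apply: eq_bigr => i _; rewrite !mxE sqrrD [RHS]addrA.
  congr (_ + _); congr (_ + _).
    rewrite expr2 big_distrl; apply: eq_bigr => j _.
    by rewrite big_distrr; apply: eq_bigr => l _ /=; rewrite mulrACA.
  rewrite -mulr_natl mulrCA mulr_suml; apply: eq_bigr => j _.
  by ring.
rewrite /mxtrace /norm2sq -big_split /=; apply: integrates_sum => i.
apply: integratesD.
  rewrite (_ : (A *m C *m A^T) i i = \sum_(j < n) \sum_(l < n) (A i j * A i l) * C j l).
    by do 2!apply: integrates_sum => ?; exact: integratesZ.
  rewrite mxE exchange_big /=; apply: eq_bigr => l _; rewrite !mxE mulr_suml /=.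
  by apply: eq_bigr => j _; rewrite mulrAC.
rewrite -[w i ord0 ^+ 2 in X in integrates _ _ X]add0r.
apply: integratesD; last exact: integrates_cst.
rewrite [X in integrates _ _ X](_ : _ = \sum_(j < n) (2 * w i ord0 * A i j) * 0).
  by apply: integrates_sum => j; exact: integratesZ.
by rewrite big1// => j _; rewrite mulr0.
Qed.

(** * Measurability and second moments on the Euclidean space *)

Lemma norm2sq_ge0 (R : realType) (d : nat) (v : 'cV[R]_d) : 0 <= norm2sq v.
Proof. by apply: sumr_ge0 => i _; exact: sqr_ge0. Qed.

Lemma coord_sqr_le_norm2sq (R : realType) (d : nat) (v : 'cV[R]_d) (i : 'I_d) :
  v i ord0 ^+ 2 <= norm2sq v.
Proof.
rewrite /norm2sq (bigD1 i)//= lerDl; apply: sumr_ge0 => j _; exact: sqr_ge0.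
Qed.

Lemma measurable_Rd (disp : measure_display) (T : measurableType disp)
    (R : realType) (d : nat) (f : T -> Rd R d) :
  (forall U : set 'cV[R]_d, open U -> measurable (f @^-1` U)) ->
  measurable_fun setT f.
Proof.
move=> fU; apply: (@measurability _ _ T (Rd R d) setT f (@open 'cV[R]_d) erefl).
by move=> _ [U oU <-]; rewrite setTI; exact: fU.
Qed.

Lemma measurable_Rd_open (R : realType) (d : nat) (U : set 'cV[R]_d) :
  open U -> measurable (U : set (Rd R d)).
Proof. by move=> oU; exact: sub_sigma_algebra. Qed.

Lemma measurable_coord (R : realType) (d : nat) (i : 'I_d) :
  measurable_fun setT (fun x : Rd R d => (x : 'cV[R]_d) i ord0).
Proof.
apply: (measurability _ (RGenOpens.measurableE R)).
move=> _ [_ [a [b ->] <-]]; rewrite setTI; apply: measurable_Rd_open.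
by move/continuousP: (@coord_continuous R d 1 i ord0); apply; exact: interval_open.
Qed.

(** A neighbourhood of a matrix contains a product of neighbourhoods of its finitely many entries,
    so the entrywise conditions can be intersected. *)
Lemma continuous_mx (R : realType) (T : topologicalType) (m n : nat)
    (f : T -> 'M[R]_(m, n)) :
  (forall i j, continuous (fun x => f x i j)) -> continuous f.
Proof.
move=> fc x A [P Pn PA].
have : \forall y \near x, forall i j, P i j (f y i j).
  by apply: filter_forall => i; apply: filter_forall => j; exact: (fc i j x _ (Pn i j)).
by apply: filterS => y Py; exact: PA.
Qed.

Lemma continuous_lincomb (R : realType) (T : topologicalType) (I : Type)
    (s : seq I) (a : I -> R) (g : I -> T -> R) (c : R) :
  (forall k, continuous (g k)) ->
  continuous (fun x => \sum_(k <- s) a k * g k x + c).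
Proof.
move=> gc x; apply: cvgD; last exact: cvg_cst.
elim: s => [|k s IH].
  under eq_fun do rewrite big_nil; rewrite big_nil; exact: cvg_cst.
under eq_fun do rewrite big_cons; rewrite big_cons.
by apply: cvgD IH; apply: cvgM; [exact: cvg_cst|exact: gc].
Qed.

Lemma continuous_affine (R : realType) (m n : nat) (A : 'M[R]_(m, n))
    (w : 'cV[R]_m) :
  continuous (fun x : 'cV[R]_n => A *m x + w).
Proof.
apply: continuous_mx => i j.
rewrite (_ : (fun x => _) =
  (fun x : 'cV[R]_n => \sum_(k < n) A i k * x k j + w i j)); last first.
  by apply/funext => x; rewrite !mxE.
by apply: continuous_lincomb => k; exact: coord_continuous.
Qed.

Lemma measurable_affine (R : realType) (d : nat) (A : 'M[R]_d) (w : 'cV[R]_d) :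
  measurable_fun setT (fun x : Rd R d => (A *m (x : 'cV[R]_d) + w : Rd R d)).
Proof.
apply: measurable_Rd => U oU; apply: measurable_Rd_open.
by move/continuousP: (@continuous_affine R d d A w); exact.
Qed.

Lemma measurable_norm2sq_affine (disp : measure_display)
    (T : measurableType disp) (R : realType) (n k : nat)
    (y : T -> 'cV[R]_n) (A : 'M[R]_(k, n)) (w : 'cV[R]_k) :
  (forall j, measurable_fun setT (fun x => y x j ord0)) ->
  measurable_fun setT (fun x => norm2sq (A *m y x + w)).
Proof.
move=> my; apply: measurable_sum => i.
apply: measurable_funX.
under eq_fun do rewrite !mxE.
apply: measurable_funD => //.
apply: measurable_sum => j.
by apply: measurable_funM.
Qed.

Lemma measurable_norm2sq (R : realType) (d : nat) :
  measurable_fun setT (fun x : Rd R d => norm2sq (x : 'cV[R]_d)).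
Proof.
apply: measurable_sum => i; apply: measurable_funX.
exact: measurable_coord.
Qed.

(** Domination by an integrable function. The factor 2 is what the product of two centred
    coordinates costs; single coordinates fit under the same bound. *)
Lemma Q2_dominated (R : realType) (d : nat) (P : probability (Rd R d) R)
    (f : Rd R d -> R) (c : R) :
  Q2 P -> measurable_fun setT f ->
  (forall x : 'cV[R]_d, `|f x| <= 2 * norm2sq x + c) ->
  integrates P f (Rintegral P setT f).
Proof.
move=> hP mf fc; split => //.
have nI : integrates P (fun x : Rd R d => norm2sq (x : 'cV[R]_d))
    (Rintegral P setT (fun x : Rd R d => norm2sq (x : 'cV[R]_d))).
  split => //; apply/integrableP; split.
    apply/measurable_EFinP; exact: measurable_norm2sq.
  under eq_integral do rewrite gee0_abs ?lee_fin ?norm2sq_ge0//.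
  exact: hP.
have [gI _] := integratesD (integratesZ 2 nI) (integrates_cst P c).
apply: le_integrable gI => //; first exact/measurable_EFinP.
by move=> x _; rewrite lee_fin (le_trans (fc x))// ler_norm.
Qed.

(** The bias-variance identity. Every moment computed below is an instance: [w] carries a change of
    centre or a translation, [A] a projection or a dilation. *)
Lemma integrates_norm2sq_centered (R : realType) (d k : nat)
    (P : probability (Rd R d) R) (A : 'M[R]_(k, d)) (w : 'cV[R]_k) :
  Q2 P ->
  integrates P
    (fun x : Rd R d => norm2sq (A *m ((x : 'cV[R]_d) - meanv P) + w))
    (\tr (A *m covm P *m A^T) + norm2sq w).
Proof.
move=> hP.
have mc (j : 'I_d) (c : R) :
    measurable_fun setT (fun x : Rd R d => (x : 'cV[R]_d) j ord0 - c).
  by apply: measurable_funB; [exact: measurable_coord|exact: measurable_cst].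
apply: integrates_norm2sq_affine => [j|j l].
  under [X in integrates _ X]eq_fun do rewrite !mxE.
  rewrite -(subrr (Rintegral P setT (fun x : Rd R d => (x : 'cV[R]_d) j ord0))).
  apply: integratesD; last exact: integrates_cst.
  apply: (@Q2_dominated R d P _ 1) => //; first exact: measurable_coord.
  move=> x; have := coord_sqr_le_norm2sq x j; set a := x j ord0 => aN.
  by rewrite ler_norml; apply/andP; split; nra.
rewrite mxE.
have subE (v m : 'cV[R]_d) i : (v - m) i ord0 = v i ord0 - m i ord0.
  by rewrite !mxE.
under [X in integrates _ X]eq_fun do rewrite !subE.
pose mj := meanv P j ord0; pose ml := meanv P l ord0.
apply: (@Q2_dominated R d P _ (mj ^+ 2 + ml ^+ 2)) => //.
  by apply: measurable_funM; exact: mc.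
move=> x; have := coord_sqr_le_norm2sq x j; have := coord_sqr_le_norm2sq x l.
rewrite -/mj -/ml; set a := x j ord0; set b := x l ord0; set N := norm2sq x.
(* With [p = a - mj] and [q = b - ml], [|p q| <= (p^2 + q^2) / 2], while [p^2 <= 2 a^2 + 2 mj^2]
   since [(a + mj)^2 >= 0], and likewise for [q]. *)
move=> bN aN; rewrite ler_norml; apply/andP; split.
  have := sqr_ge0 (a - mj + (b - ml)); have := sqr_ge0 (a + mj).
  have := sqr_ge0 (b + ml); lra.
have := sqr_ge0 (a - mj - (b - ml)); have := sqr_ge0 (a + mj).
have := sqr_ge0 (b + ml); lra.
Qed.

(** * Euclidean norm and orthogonal projections *)

Lemma norm2sq_mxE (R : realType) (d : nat) (v : 'cV[R]_d) :
  norm2sq v = (v^T *m v) ord0 ord0.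
Proof. by rewrite mxE; apply: eq_bigr => i _; rewrite mxE expr2. Qed.

Lemma norm2sqZ (R : realType) (d : nat) (k : R) (v : 'cV[R]_d) :
  norm2sq (k *: v) = k ^+ 2 * norm2sq v.
Proof. by rewrite /norm2sq mulr_sumr; apply: eq_bigr => i _; rewrite mxE exprMn. Qed.

Lemma norm2sq_eq0 (R : realType) (d : nat) (v : 'cV[R]_d) :
  norm2sq v = 0 -> v = 0.
Proof.
move=> v0; apply/matrixP => i j; rewrite ord1 mxE; apply/eqP.
by rewrite -sqrf_eq0 eq_le sqr_ge0 -[X in _ <= X]v0 coord_sqr_le_norm2sq.
Qed.

(** In each coordinate the two sides differ by the square [t (a - b / t)^2]. *)
Lemma norm2sqD_young (R : realType) (d : nat) (t : R) (v w : 'cV[R]_d) :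
  0 < t ->
  norm2sq (v + w) <= (1 + t) * norm2sq v + (1 + t^-1) * norm2sq w.
Proof.
move=> t0; rewrite /norm2sq !mulr_sumr -big_split /=; apply: ler_sum => i _.
rewrite mxE; set a := v i ord0; set b := w i ord0.
have -> : (1 + t) * a ^+ 2 + (1 + t^-1) * b ^+ 2 =
    (a + b) ^+ 2 + t * (a - t^-1 * b) ^+ 2 by field; rewrite gt_eqF.
by rewrite lerDl mulr_ge0 ?sqr_ge0// ltW.
Qed.

(** Averaging over a random sign cancels the cross terms. *)
Lemma norm2sq_parallelogram (R : realType) (d : nat) (v w : 'cV[R]_d) :
  2^-1 * norm2sq (v + w) + 2^-1 * norm2sq (v - w) = norm2sq v + norm2sq w.
Proof.
rewrite /norm2sq !mulr_sumr -!big_split /=; apply: eq_bigr => i _.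
by rewrite !mxE; field.
Qed.

Definition orthoproj (R : realType) (d : nat) (E : 'M[R]_d) : Prop :=
  E^T = E /\ E *m E = E.

Lemma orthoproj_stiefel (R : realType) (d r : nat) (X : 'M[R]_(d, r)) :
  stiefel X -> orthoproj (1%:M - X *m X^T).
Proof.
rewrite /stiefel /= => XX; split.
  by rewrite linearB /= trmx1 trmx_mul trmxK.
rewrite mulmxBl mul1mx mulmxBr mulmx1 -mulmxA (mulmxA X^T) XX mul1mx subrr.
by rewrite subr0.
Qed.

Lemma orthoprojC (R : realType) (d : nat) (E : 'M[R]_d) :
  orthoproj E -> orthoproj (1%:M - E).
Proof.
move=> [Et EE]; split; first by rewrite linearB /= trmx1 Et.
by rewrite mulmxBl mul1mx mulmxBr mulmx1 EE subrr subr0.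
Qed.

Lemma orthoproj_norm2sq (R : realType) (d : nat) (E : 'M[R]_d) (v : 'cV[R]_d) :
  orthoproj E -> norm2sq (E *m v) = (v^T *m (E *m v)) ord0 ord0.
Proof.
by move=> [Et EE]; rewrite norm2sq_mxE trmx_mul Et -mulmxA (mulmxA E) EE.
Qed.

(** Pythagoras: the defect is the squared norm of the complementary projection [(1%:M - E) *m v]. *)
Lemma orthoproj_norm2sq_le (R : realType) (d : nat) (E : 'M[R]_d)
    (v : 'cV[R]_d) :
  orthoproj E -> norm2sq (E *m v) <= norm2sq v.
Proof.
move=> hE; rewrite -subr_ge0.
rewrite (_ : _ - _ = norm2sq ((1%:M - E) *m v)) ?norm2sq_ge0//.
rewrite !orthoproj_norm2sq//; last exact: orthoprojC.
by rewrite norm2sq_mxE mulmxBl mul1mx mulmxBr [RHS]mxE [X in _ = _ + X]mxE.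
Qed.

(** Cyclicity of the trace brings the two copies of [E] together, and they merge by idempotence. *)
Lemma orthoproj_trace (R : realType) (d : nat) (E C : 'M[R]_d) (k : R) :
  orthoproj E -> \tr ((k *: E) *m C *m (k *: E)^T) = k ^+ 2 * \tr (E *m C).
Proof.
move=> [Et EE]; rewrite linearZ /= Et -scalemxAr -!scalemxAl scalerA mxtraceZ.
by rewrite -mulmxA mxtrace_mulC -mulmxA EE mxtrace_mulC.
Qed.

Lemma stiefel_unit_normal (R : realType) (d r : nat) (X : 'M[R]_(d, r)) :
  (r < d)%N ->
  exists u : 'cV[R]_d, (1%:M - X *m X^T) *m u = u /\ norm2sq u = 1.
Proof.
move=> rd.
(* The rank of [X] is at most [r < d], so its left kernel is nonzero; a row [v] with [v *m X = 0]
   transposes to a vector fixed by the projection. *)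
have /rowV0Pn[v /sub_kermxP vX v0] : kermx X != 0.
  rewrite -mxrank_eq0 mxrank_ker -lt0n subn_gt0.
  exact: leq_ltn_trans (rank_leq_col X) rd.
have Nv : 0 < norm2sq v^T.
  rewrite lt_def norm2sq_ge0 andbT; apply: contra_neq v0 => /norm2sq_eq0 v0.
  by rewrite -[v]trmxK v0 trmx0.
exists ((Num.sqrt (norm2sq v^T))^-1 *: v^T); split.
  by rewrite -scalemxAr mulmxBl mul1mx -mulmxA -trmx_mul vX trmx0 mulmx0 subr0.
by rewrite norm2sqZ exprVn sqr_sqrtr ?ltW// mulVf// gt_eqF.
Qed.

Lemma frobE (R : realType) (m n : nat) (A : 'M[R]_(m, n)) :
  frob A = Num.sqrt (\tr (A *m A^T)).
Proof.
congr Num.sqrt; apply: eq_bigr => i _; rewrite mxE; apply: eq_bigr => j _.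
by rewrite mxE expr2.
Qed.

(** * Upper bound: variance along a coupling *)

Lemma measurable_norm2sq_sub (R : realType) (d : nat) :
  measurable_fun setT (fun z : (Rd R d * Rd R d)%type =>
    norm2sq ((z.1 : 'cV[R]_d) - (z.2 : 'cV[R]_d))).
Proof.
have m1 (j : 'I_d) : measurable_fun setT
    (fun z : (Rd R d * Rd R d)%type => (z.1 : 'cV[R]_d) j ord0).
  exact: (measurableT_comp (@measurable_coord R d j) measurable_fst).
have m2 (j : 'I_d) : measurable_fun setT
    (fun z : (Rd R d * Rd R d)%type => (z.2 : 'cV[R]_d) j ord0).
  exact: (measurableT_comp (@measurable_coord R d j) measurable_snd).
apply: measurable_sum => i; apply: measurable_funX.
under eq_fun do rewrite !mxE.
by apply: measurable_funB.
Qed.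

(** Change of variables, with the image law given by its values on measurable sets, as [couplings]
    provides it. *)
Lemma integral_marginal (d1 d2 : measure_display) (S : measurableType d1)
    (T : measurableType d2) (R : realType) (Q : probability S R)
    (P : probability T R) (g : S -> T) (f : T -> R) :
  measurable_fun setT g ->
  (forall A, measurable A -> Q (g @^-1` A) = P A) ->
  measurable_fun setT f -> (forall x, 0 <= f x) ->
  (\int[P]_x (f x)%:E = \int[Q]_z (f (g z))%:E)%E.
Proof.
move=> mg QP mf f0.
rewrite (eq_measure_integral (pushforward Q g)); last first.
  by move=> A mA _; exact: (esym (QP A mA)).
rewrite ge0_integral_pushforward//; last by move=> x _; rewrite lee_fin.
exact/measurable_EFinP.
Qed.

(** The transport cost may be infinite, so the estimate stays in the extended reals. *)
Lemma coupling_variance_le (R : realType) (d : nat)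
    (P P0 : probability (Rd R d) R) (Q : probability (Rd R d * Rd R d)%type R)
    (E : 'M[R]_d) (t : R) :
  Q2 P -> Q2 P0 -> couplings P P0 Q -> orthoproj E -> 0 < t ->
  ((\tr (E *m covm P))%:E <= ((1 + t) * \tr (E *m covm P0))%:E +
    (1 + t^-1)%:E * \int[Q]_z (norm2sq ((z.1 : 'cV[R]_d) - (z.2 : 'cV[R]_d)))%:E)%E.
Proof.
move=> hP hP0 hQ hE t0.
have trE (C : 'M[R]_d) : \tr (E *m C *m E^T) = \tr (E *m C).
  by have := orthoproj_trace C 1 hE; rewrite scale1r expr1n mul1r.
pose m0 := meanv P0.
have mE : measurable_fun setT
    (fun x : Rd R d => norm2sq (E *m (x : 'cV[R]_d) + - (E *m m0))).
  by apply: measurable_norm2sq_affine => j; exact: measurable_coord.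
have E0 (x : 'cV[R]_d) : norm2sq (E *m x + - (E *m m0)) = norm2sq (E *m (x - m0)).
  by rewrite mulmxBr.
(* Recentring from the mean of [P] to [m0] adds the nonnegative bias
   [norm2sq (E *m (meanv P - m0))]. *)
have leP : ((\tr (E *m covm P))%:E <=
    \int[P]_x (norm2sq (E *m (x : 'cV[R]_d) + - (E *m m0)))%:E)%E.
  have /integrates_integral := integrates_norm2sq_centered E (E *m (meanv P - m0)) hP.
  rewrite trE; under eq_integral do rewrite -mulmxDr addrA subrK -E0.
  by move=> ->; rewrite lee_fin lerDl norm2sq_ge0.
apply: le_trans leP _.
rewrite (@integral_marginal _ _ _ _ _ Q P fst)//; last 2 first.
- by move=> A mA; have [] := hQ A mA.
- by move=> x; exact: norm2sq_ge0.
have eP0 : (((1 + t) * \tr (E *m covm P0))%:E = (1 + t)%:E *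
    \int[Q]_z (norm2sq (E *m (z.2 : 'cV[R]_d) + - (E *m m0)))%:E)%E.
  rewrite -(@integral_marginal _ _ _ _ _ Q P0 snd
    (fun x : Rd R d => norm2sq (E *m (x : 'cV[R]_d) + - (E *m m0))))//; last 2 first.
  - by move=> A mA; have [] := hQ A mA.
  - by move=> x; exact: norm2sq_ge0.
  have /integrates_integral := integrates_norm2sq_centered E 0 hP0.
  rewrite trE; under eq_integral do rewrite addr0 -E0.
  move=> ->; rewrite (_ : norm2sq 0 = 0) ?addr0//.
  by apply: big1 => i _; rewrite mxE expr0n.
have mc := @measurable_norm2sq_sub R d.
have m2 := measurableT_comp mE (@measurable_snd _ _ (Rd R d) (Rd R d)).
have t1 : 0 <= 1 + t by rewrite addr_ge0// ltW.
have t2 : 0 <= 1 + t^-1 by rewrite addr_ge0// invr_ge0 ltW.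
pose F2 (z : (Rd R d * Rd R d)%type) : \bar R :=
  (norm2sq (E *m (z.2 : 'cV[R]_d) + - (E *m m0)))%:E.
pose Fd (z : (Rd R d * Rd R d)%type) : \bar R :=
  (norm2sq ((z.1 : 'cV[R]_d) - (z.2 : 'cV[R]_d)))%:E.
have mF2 : measurable_fun setT F2 by apply/measurable_EFinP; exact: m2.
have mFd : measurable_fun setT Fd by apply/measurable_EFinP; exact: mc.
have F20 z : (0 <= F2 z)%E by rewrite lee_fin norm2sq_ge0.
have Fd0 z : (0 <= Fd z)%E by rewrite lee_fin norm2sq_ge0.
have mZ (k : R) (F : (Rd R d * Rd R d)%type -> \bar R) :
    measurable_fun setT F -> measurable_fun setT (fun z => k%:E * F z)%E.
  by move=> mF; exact: measurable_funeM.
rewrite eP0 -/F2 -(ge0_integralZl Q measurableT mF2)//.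
rewrite -(ge0_integralZl Q measurableT mFd)//.
rewrite -ge0_integralD//; first last.
- exact: mZ.
- by move=> z _; rewrite mule_ge0.
- exact: mZ.
- by move=> z _; rewrite mule_ge0.
apply: ge0_le_integral => //.
- by move=> z _; rewrite lee_fin norm2sq_ge0.
- apply/measurable_EFinP.
  exact: (measurableT_comp mE (@measurable_fst _ _ (Rd R d) (Rd R d))).
- by apply: emeasurable_funD; exact: mZ.
move=> z _; rewrite -!EFinM -EFinD lee_fin.
pose z1 : 'cV[R]_d := z.1; pose z2 : 'cV[R]_d := z.2.
(* Young's inequality is applied to [E (z1 - m0) = E (z2 - m0) + E (z1 - z2)], and [E] contracts the
   last term. *)
have -> : E *m z1 + - (E *m m0) = (E *m z2 + - (E *m m0)) + E *m (z1 - z2).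
  by rewrite mulmxBr addrC [RHS]addrC addrA subrK addrC.
apply: le_trans (norm2sqD_young _ _ t0) _.
by rewrite lerD2l ler_wpM2l// orthoproj_norm2sq_le.
Qed.

(** For positive [V] and [rho] the right-hand side is least at [t = rho / sqrt V]. This choice
    degenerates when [V] or [rho] vanishes, hence the slack [e] in the proof. *)
Lemma le_sqr_sqrtD (R : realType) (A V rho : R) :
  0 <= V -> 0 <= rho ->
  (forall t, 0 < t -> A <= (1 + t) * V + (1 + t^-1) * rho ^+ 2) ->
  A <= (Num.sqrt V + rho) ^+ 2.
Proof.
move=> V0 r0 hA; set s := Num.sqrt V.
have s0 : 0 <= s by exact: sqrtr_ge0.
have [A0|A0] := lerP A 0; first by rewrite (le_trans A0)// sqr_ge0.
rewrite -[leLHS](sqr_sqrtr (ltW A0)) ler_sqr ?nnegrE ?sqrtr_ge0 ?addr_ge0//.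
apply/ler_addgt0Pr => e e0.
rewrite -(@ler_sqr _ (Num.sqrt A)) ?nnegrE ?sqrtr_ge0 ?addr_ge0 ?(ltW e0)//.
rewrite (sqr_sqrtr (ltW A0)).
(* Splitting [e] evenly makes [p] and [q] positive, and [t = q / p] turns the bound with [p^2],
   [q^2] in place of [V], [rho^2] into exactly [(p + q)^2]. *)
pose p := s + e / 2; pose q := rho + e / 2.
have p0 : 0 < p by rewrite /p; lra.
have q0 : 0 < q by rewrite /q; lra.
apply: le_trans (hA (q / p) (divr_gt0 q0 p0)) _.
have -> : s + rho + e = p + q by rewrite /p /q; field.
have -> : (p + q) ^+ 2 = (1 + q / p) * p ^+ 2 + (1 + (q / p)^-1) * q ^+ 2.
  by field; rewrite !gt_eqF.
rewrite -(sqr_sqrtr V0) -/s lerD//.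
  rewrite ler_wpM2l ?addr_ge0 ?divr_ge0 ?(ltW p0) ?(ltW q0)//.
  by rewrite ler_sqr ?nnegrE ?(ltW p0)// /p; lra.
rewrite ler_wpM2l ?addr_ge0 ?invr_ge0 ?divr_ge0 ?(ltW p0) ?(ltW q0)//.
by rewrite ler_sqr ?nnegrE ?(ltW q0)// /q; lra.
Qed.

(** * Lower bound: an explicit worst-case distribution *)

(** Half the sum of two image measures realises an independent fair sign without enlarging the
    probability space. The formula on sets serves the marginals, the one on integrals the
    moments. *)
Lemma exists_mixture (d1 d2 : measure_display) (S : measurableType d1)
    (T : measurableType d2) (R : realType) (mu : probability S R)
    (g1 g2 : S -> T) :
  measurable_fun setT g1 -> measurable_fun setT g2 ->
  exists Q : probability T R,
    (forall A, measurable A ->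
       Q A = (2^-1%:E * (mu (g1 @^-1` A) + mu (g2 @^-1` A)))%E) /\
    (forall f : T -> R, measurable_fun setT f -> (forall x, 0 <= f x) ->
       (\int[Q]_y (f y)%:E = 2^-1%:E *
         (\int[mu]_x (f (g1 x))%:E + \int[mu]_x (f (g2 x))%:E))%E).
Proof.
move=> mg1 mg2.
pose G1 : {mfun S >-> T} := HB.pack g1 (isMeasurableFun.Build _ _ _ _ g1 mg1).
pose G2 : {mfun S >-> T} := HB.pack g2 (isMeasurableFun.Build _ _ _ _ g2 mg2).
pose P1 : probability T R := distribution mu G1.
pose P2 : probability T R := distribution mu G2.
have h0 : 0 <= 2^-1 :> R by [].
pose m := mscale (NngNum h0) (measure_add P1 P2).
have mE A : m A = (2^-1%:E * (mu (g1 @^-1` A) + mu (g2 @^-1` A)))%E.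
  by congr (_ * _)%E; exact: (measure_addE P1 P2 A).
have mT : m setT = 1%E.
  rewrite mE !preimage_setT !probability_setT -EFinD -EFinM.
  by congr EFin; field.
pose Q : probability T R := HB.pack m (Measure_isProbability.Build _ _ _ m mT).
exists Q; split; first by move=> A _; exact: mE.
move=> f mf f0.
have mf' : measurable_fun setT (fun y => (f y)%:E) by exact/measurable_EFinP.
have f0' y : [set: T] y -> (0 <= (f y)%:E)%E by rewrite lee_fin.
rewrite [LHS](ge0_integral_mscale (measure_add P1 P2) measurableT (NngNum h0) mf' f0').
rewrite ge0_integral_measure_add//.
by congr (_ * (_ + _))%E; rewrite ge0_integral_pushforward// => y _; rewrite lee_fin.
Qed.

(* P is the law of [x + a E (x - m0) + e b u] with x drawn from P0 and e an
   independent uniform sign.  The last bound is needed only at the mean of P,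
   but holding for every center c spares the computation of that mean. *)
Lemma worst_case_distribution (R : realType) (d : nat)
    (P0 : probability (Rd R d) R) (E : 'M[R]_d) (u : 'cV[R]_d) (a b : R) :
  Q2 P0 -> orthoproj E -> E *m u = u -> norm2sq u = 1 ->
  let V := \tr (E *m covm P0) in
  exists P : probability (Rd R d) R, [/\ Q2 P,
    exists2 Q, couplings P P0 Q &
      (\int[Q]_z (norm2sq ((z.1 : 'cV[R]_d) - (z.2 : 'cV[R]_d)))%:E =
        (a ^+ 2 * V + b ^+ 2)%:E)%E &
    forall c : 'cV[R]_d, (((1 + a) ^+ 2 * V + b ^+ 2)%:E <=
      \int[P]_x (norm2sq (E *m ((x : 'cV[R]_d) - c)))%:E)%E].
Proof.
move=> hP0 hE Eu u1 V; have [Et EE] := hE.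
pose m0 := meanv P0.
pose T (s : R) (x : Rd R d) : Rd R d :=
  (1%:M + a *: E) *m (x : 'cV[R]_d) + (s *: u - a *: (E *m m0)).
have TE s (x : 'cV[R]_d) : T s x = x + a *: (E *m (x - m0)) + s *: u :> 'cV[R]_d.
  rewrite /T mulmxDl mul1mx -scalemxAl mulmxBr scalerBr -!addrA; congr (_ + (_ + _)).
  by rewrite addrC.
have mT s : measurable_fun setT (T s) by exact: measurable_affine.
(* Keeping [x] as second component makes the mixture of [g b] and [g (- b)] a coupling with [P0]. *)
pose g s (x : Rd R d) : (Rd R d * Rd R d)%type := (T s x, x).
have mg s : measurable_fun setT (g s).
  by apply: measurable_fun_pair => //; exact: mT.
have [Q [QA QI]] := exists_mixture P0 (mg b) (mg (- b)).
pose F1 : {mfun (Rd R d * Rd R d)%type >-> Rd R d} := HB.pack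
  (fst : (Rd R d * Rd R d)%type -> Rd R d)
  (isMeasurableFun.Build _ _ (Rd R d * Rd R d)%type (Rd R d) fst measurable_fst).
pose P : probability (Rd R d) R := distribution Q F1.
have PI (f : Rd R d -> R) : measurable_fun setT f -> (forall x, 0 <= f x) ->
    (\int[P]_y (f y)%:E = 2^-1%:E *
      (\int[P0]_x (f (T b x))%:E + \int[P0]_x (f (T (- b) x))%:E))%E.
  move=> mf f0; rewrite (@integral_marginal _ _ _ _ _ Q P fst)//.
  rewrite QI//.
  exact: (measurableT_comp mf measurable_fst).
(* The second moment, the transport cost and the residual all reduce to this, with [A] equal to
   [1%:M + a *: E], [a *: E] and [(1 + a) *: E] respectively. *)
have moment (A : 'M[R]_d) (w : 'cV[R]_d) (f : Rd R d -> R) :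
    (forall x : 'cV[R]_d, f x = norm2sq (A *m (x - m0) + w)) ->
    (\int[P0]_x (f x)%:E = (\tr (A *m covm P0 *m A^T) + norm2sq w)%:E)%E.
  move=> fE; rewrite -(integrates_integral (integrates_norm2sq_centered A w hP0)).
  by apply: eq_integral => x _; rewrite fE.
exists P; split.
- rewrite /Q2 /= PI; last 2 first.
  + exact: measurable_norm2sq.
  + exact: norm2sq_ge0.
  have mom s := moment (1%:M + a *: E) (m0 + s *: u).
  have EQ s (x : 'cV[R]_d) : norm2sq (T s x) =
      norm2sq ((1%:M + a *: E) *m (x - m0) + (m0 + s *: u)).
    rewrite TE mulmxDl mul1mx -scalemxAl; congr norm2sq.
    by apply/matrixP => i j; rewrite !mxE; ring.
  by rewrite (mom b) ?(mom (- b)) ?ltry.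
- exists Q.
    move=> A mA; split=> //; rewrite QA.
      rewrite (_ : g b @^-1` _ = A)// (_ : g (- b) @^-1` _ = A)//.
      rewrite -[P0 A]fineK ?fin_num_measure// -EFinD -EFinM; by congr EFin; field.
    by have := @measurable_snd _ _ (Rd R d) (Rd R d) measurableT A mA; rewrite setTI.
  rewrite (QI _ (@measurable_norm2sq_sub R d)); last first.
    by move=> z; exact: norm2sq_ge0.
  (* The displacement is [T s x - x = a E (x - m0) + s u]; both signs give the same cost since [u]
     is a unit vector. *)
  have mom s := moment (a *: E) (s *: u).
  rewrite (mom b) ?(mom (- b)).
  + rewrite orthoproj_trace// !norm2sqZ u1 sqrrN -EFinD -EFinM; congr EFin.
    by rewrite /V; field.
  + by move=> x; rewrite /= TE -scalemxAl addrC -addrA addKr.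
  + by move=> x; rewrite /= TE -scalemxAl addrC -addrA addKr.
- move=> c; rewrite PI; last 2 first.
  + under eq_fun do rewrite mulmxBr.
    by apply: measurable_norm2sq_affine => j; exact: measurable_coord.
  + by move=> x; exact: norm2sq_ge0.
  have mom s := moment ((1 + a) *: E) (E *m (m0 - c) + s *: u).
  (* Since [E] fixes [u], the sign enters only through [E (m0 - c) + s u]. The parallelogram law
     then averages its squared norm to [norm2sq (E *m (m0 - c)) + b ^+ 2], whose first term is
     dropped. *)
  have EQ s (x : 'cV[R]_d) : E *m ((T s x : 'cV[R]_d) - c) =
      ((1 + a) *: E) *m (x - m0) + (E *m (m0 - c) + s *: u).
    rewrite TE -scalemxAl scalerDl scale1r.
    have -> : x + a *: (E *m (x - m0)) + s *: u - c =
        (x - m0) + a *: (E *m (x - m0)) + ((m0 - c) + s *: u).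
      rewrite addrACA; apply/matrixP => i j; rewrite !mxE; ring.
    move: (x - m0) (m0 - c) => y z.
    by rewrite !mulmxDr -!scalemxAr Eu mulmxA EE.
  rewrite (mom b) ?(mom (- b)); try by move=> x; rewrite EQ.
  rewrite orthoproj_trace// -EFinD -EFinM lee_fin.
  have := norm2sq_parallelogram (E *m (m0 - c)) (b *: u).
  rewrite scaleNr norm2sqZ u1 mulr1 => par.
  have := norm2sq_ge0 (E *m (m0 - c)).
  rewrite /V; lra.
Qed.

(** * The closed form of [phi] and the equivalent problem *)

(** Monotonicity of the extended square root turns the ball constraint into a bound on the infimum
    of transport costs. *)
Lemma le_W2 (R : realType) (d : nat) (P P0 : probability (Rd R d) R) (rho : R) :
  0 <= rho ->
  (W2 P P0 <= rho%:E)%E <->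
  (ereal_inf [set \int[Q]_z (norm2sq ((z.1 : 'cV[R]_d) - (z.2 : 'cV[R]_d)))%:E
     | Q in couplings P P0] <= (rho ^+ 2)%:E)%E.
Proof.
move=> r0; rewrite /W2.
rewrite -(lee_sqrt _ (y := (rho ^+ 2)%:E)) ?lee_fin ?sqr_ge0//.
by rewrite /= sqrtr_sqr ger0_norm.
Qed.

Lemma integral_residual (R : realType) (d : nat) (P : probability (Rd R d) R)
    (E : 'M[R]_d) :
  Q2 P -> orthoproj E ->
  (\int[P]_x (norm2sq (E *m ((x : 'cV[R]_d) - meanv P)))%:E =
   (\tr (E *m covm P))%:E)%E.
Proof.
move=> hP hE.
have /integrates_integral := integrates_norm2sq_centered E 0 hP.
have := orthoproj_trace (covm P) 1 hE; rewrite scale1r expr1n mul1r => ->.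
rewrite (_ : norm2sq 0 = 0) ?addr0; last by apply: big1 => i _; rewrite mxE expr0n.
by under eq_integral do rewrite addr0.
Qed.

Lemma phiE (R : realType) (d r : nat) (P0 : probability (Rd R d) R) (rho : R)
    (X : 'M[R]_(d, r)) :
  (r < d)%N -> Q2 P0 -> 0 <= rho -> stiefel X ->
  phi P0 rho X =
  ((Num.sqrt (\tr ((1%:M - X *m X^T) *m covm P0)) + rho) ^+ 2)%:E.
Proof.
move=> rd hP0 rho0 hX; have hE := orthoproj_stiefel hX.
have [u [Eu u1]] := stiefel_unit_normal X rd.
rewrite /phi; move: hE Eu; set E := 1%:M - X *m X^T => hE Eu.
set V := \tr (E *m covm P0).
have V0 : 0 <= V.
  rewrite -lee_fin -integral_residual//; apply: integral_ge0 => x _.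
  by rewrite lee_fin norm2sq_ge0.
apply/eqP; rewrite eq_le; apply/andP; split.
  apply: ge_ereal_sup => _ [P [hP /(le_W2 P P0 rho0) W] <-].
  rewrite integral_residual// lee_fin; apply: le_sqr_sqrtD => // t t0.
  have k0 : 0 < 1 + t^-1 by rewrite addr_gt0// invr_gt0.
  (* Solved for the cost, the coupling estimate gives a lower bound common to all couplings, hence
     for their infimum; no optimal coupling has to exist. *)
  rewrite -lerBlDl [leRHS]mulrC -ler_pdivrMr// -lee_fin; apply: le_trans W.
  apply: le_ereal_inf_tmp => _ [Q hQ <-].
  have := coupling_variance_le hP hP0 hQ hE t0.
  have : (0 <= \int[Q]_z (norm2sq ((z.1 : 'cV[R]_d) - (z.2 : 'cV[R]_d)))%:E)%E.
    by apply: integral_ge0 => z _; rewrite lee_fin norm2sq_ge0.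
  case: (integral _ _ _) => [I||//] _; last by rewrite leey.
  by rewrite -EFinM -EFinD !lee_fin ler_pdivrMr// lerBlDl [X in _ + X]mulrC.
(* For [V = 0] the division gives [a = 0]. *)
pose a := rho / Num.sqrt V; pose b := if V == 0 then rho else 0.
(* [Ea] makes the residual reach the target and [Eb] makes the cost exhaust the budget [rho ^+ 2].
   For [V != 0] both follow from [a * sqrt V = rho] and [b = 0]. *)
have [Ea Eb] : (1 + a) ^+ 2 * V + b ^+ 2 = (Num.sqrt V + rho) ^+ 2 /\
    a ^+ 2 * V + b ^+ 2 = rho ^+ 2.
  rewrite /a /b; have [->|Vn0] := eqVneq V 0.
    by rewrite sqrtr0 !mulr0 !add0r.
  have s0 : Num.sqrt V != 0 by rewrite gt_eqF// sqrtr_gt0 lt_def Vn0.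
  by split; rewrite -{2}(sqr_sqrtr V0); field.
have [P [hP [Q hQ QI] lbP]] := worst_case_distribution a b hP0 hE Eu u1.
rewrite -Ea; apply: le_trans (lbP (meanv P)) _; apply: ereal_sup_ubound.
exists P => //; split => //; apply/le_W2 => //.
by apply: ge_ereal_inf; exists (rho ^+ 2)%:E => //; exists Q => //; rewrite QI Eb.
Qed.

Theorem mainTheorem5 (R : realType) (d r : nat)
  (hr1 : (1 <= r)%N) (hrd : (r < d)%N)
  (P0 : probability (Rd R d) R) (hP0 : Q2 P0) (rho : R) (hrho : 0 <= rho) :
  (forall X : 'M[R]_(d, r), stiefel X ->
     phi P0 rho X =
     ((Num.sqrt (\tr ((1%:M - X *m X^T) *m covm P0)) + rho) ^+ 2)%:E)
  /\
  (forall (S : 'M[R]_d), psd S -> S *m S = covm P0 ->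
   forall s : 'M[R]_(d, r) -> R,
   let surr := fun X : 'M[R]_(d, r) =>
     \tr ((1%:M - X *m X^T) *m covm P0) + s X
     + 2 * rho * frob ((1%:M - X *m X^T) *m S) in
   (forall X : 'M[R]_(d, r), stiefel X ->
      (phi P0 rho X + (s X)%:E = (surr X + rho ^+ 2)%:E)%E)
   /\
   (forall X : 'M[R]_(d, r), stiefel X ->
      ((forall Y, stiefel Y -> (phi P0 rho X + (s X)%:E <= phi P0 rho Y + (s Y)%:E)%E)
       <-> (forall Y, stiefel Y -> surr X <= surr Y)))).
Proof.
have phi_val X := @phiE R d r P0 rho X hrd hP0 hrho.
split; first exact: phi_val.
move=> S [St _] SS s surr.
have phi_surr X : stiefel X -> (phi P0 rho X + (s X)%:E = (surr X + rho ^+ 2)%:E)%E.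
  move=> hX; have hE := orthoproj_stiefel hX; have [Et _] := hE.
  (* With [E] the projection, the squared Frobenius norm is [tr (E S S^T E^T) = tr (E Sigma E^T) =
     tr (E Sigma)]. *)
  have fE : frob ((1%:M - X *m X^T) *m S) =
      Num.sqrt (\tr ((1%:M - X *m X^T) *m covm P0)).
    have := orthoproj_trace (covm P0) 1 hE; rewrite scale1r expr1n mul1r => <-.
    by rewrite frobE trmx_mul Et St -SS !mulmxA.
  have V0 : 0 <= \tr ((1%:M - X *m X^T) *m covm P0).
    rewrite -lee_fin -integral_residual//.
    by apply: integral_ge0 => x _; rewrite lee_fin norm2sq_ge0.
  rewrite phi_val// -EFinD /surr fE; congr EFin.
  by rewrite -{2}(sqr_sqrtr V0); ring.
split; first exact: phi_surr.
(* The two objectives differ on the feasible set by the constant [rho ^+ 2], and this alone gives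
   the same minimisers. *)
move: (phi P0 rho) surr phi_surr {phi_val} => f surr f_surr.
move=> X hX; split=> h Y hY; have := h Y hY.
  by rewrite (f_surr X hX) (f_surr Y hY) lee_fin lerD2r.
by rewrite (f_surr X hX) (f_surr Y hY) lee_fin lerD2r.
Qed.
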